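(* Let $G$ be a group together with a norm $\|\cdot\|$ that induces the metric $d(g,h)=\|gh^{-1}\|$. Assume there exist constants $K,L$ and maps $p_k:G\to G$ for all $k\in\mathbb{N}=\{0,1,2,\dots\}$ with $p_0=\mathrm{id}$ such that (i) $d(p_k(g),p_k(h))\le K\,d(g,h)$ for all $k\in\mathbb{N}$, $g,h\in G$; (ii) $d(p_k(g),p_\ell(g))\le L\,|k-\ell|$ for all $k,\ell\in\mathbb{N}$, $g\in G$; (iii) $\|p_k(g)\|\le\big|\,\|g\|-k\,\big|$ for all $k\in\mathbb{N}$, $g\in G$. Then all asymptotic cones of $G$ are contractible; that is, $\mathrm{Cone}_\omega(G,s_n)$ is contractible for all non-principal ultrafilters $\omega$ on $\mathbb{N}$ and all scaling sequences $(s_n)$.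
   Context: A norm on a group $G$ is a function $\|\cdot\|:G\to[0,\infty)$ with $\|g\|=0$ iff $g=1$ and $\|gh\|\le\|g\|+\|h\|$; it is not assumed conjugation invariant here, but it is assumed that $d(g,h)=\|gh^{-1}\|$ is a metric (i.e. $\|g^{-1}\|=\|g\|$). A scaling sequence is a sequence $(s_n)$ of positive reals with $\lim_\omega s_n=\infty$. A sequence $(x_n)$ in $G$ is admissible if $\|x_n\|/s_n$ is bounded. $\mathrm{Cone}_\omega(G,s_n)$ is the metric space of admissible sequences modulo $(x_n)\sim(y_n)$ iff $\lim_\omega d(x_n,y_n)/s_n=0$, with metric $d([x_n],[y_n])=\lim_\omega d(x_n,y_n)/s_n$. *)

(* Defs.v *)
From HB Require Import structures.
From mathcomp Require Import all_boot all_order all_algebra generic_quotient.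
From mathcomp Require Import all_classical all_reals all_analysis.

Set Implicit Arguments.
Unset Strict Implicit.
Unset Printing Implicit Defensive.

Import Order.TTheory GRing.Theory Num.Theory.
Import numFieldNormedType.Exports.

Local Open Scope classical_set_scope.
Local Open Scope ring_scope.
Local Open Scope quotient_scope.

(* No conjugation invariance; [gnormV] makes [gdist] symmetric. *)
Record group_norm (R : realType) (G : groupType) := GroupNorm {
  gnorm :> G -> R;
  gnorm_ge0 : forall g, 0 <= gnorm g;
  gnorm_eq0 : forall g, gnorm g = 0 <-> g = 1%g;
  gnormM : forall g h, gnorm (g * h)%g <= gnorm g + gnorm h;
  gnormV : forall g, gnorm (g^-1)%g = gnorm g
}.

Definition gdist (R : realType) (G : groupType) (N : group_norm R G)
  (g h : G) : R := N (g * h^-1)%g.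

Record nonprincipal_ultrafilter := NonprincipalUltrafilter {
  ultra_sets :> set_system nat;
  ultra_setsP : UltraFilter ultra_sets;
  ultra_nonprincipal : forall n : nat, ~ ultra_sets [set n]
}.
#[global] Existing Instance ultra_setsP.

Record scaling_sequence (R : realType) (w : nonprincipal_ultrafilter) :=
  ScalingSequence {
  scale :> nat -> R;
  scale_gt0 : forall n, 0 < scale n;
  scale_cvg : scale n @[n --> ultra_sets w] --> +oo
}.

Section GdistTheory.
Context (R : realType) (G : groupType) (N : group_norm R G).

Lemma gdist_ge0 (g h : G) : 0 <= gdist N g h.
Proof. exact: gnorm_ge0. Qed.

Lemma gdistxx (g : G) : gdist N g g = 0.
Proof. by rewrite /gdist mulgV; apply/gnorm_eq0. Qed.

Lemma gdist_positivity (g h : G) : gdist N g h = 0 -> g = h.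
Proof. by move=> /gnorm_eq0 /divg1_eq. Qed.

Lemma gdistC (g h : G) : gdist N g h = gdist N h g.
Proof. by rewrite /gdist -gnormV invgM invgK. Qed.

Lemma gdist_triangle (h g k : G) : gdist N g k <= gdist N g h + gdist N h k.
Proof.
rewrite /gdist; have -> : (g * k^-1 = (g * h^-1) * (h * k^-1))%g.
  by rewrite mulgA mulgVK.
exact: gnormM.
Qed.

Lemma gdist1 (g : G) : gdist N g 1%g = N g.
Proof. by rewrite /gdist invg1 mulg1. Qed.

End GdistTheory.

Lemma ultra_bounded_cvg (R : realType) (T : Type) (F : set_system T)
    (FU : UltraFilter F) (u : T -> R) (a b : R) :
  (forall t, a <= u t <= b) -> cvg (u t @[t --> F]).
Proof.
move=> uab.
have UF : UltraFilter (u t @[t --> F]).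
  split=> [|H HP FH]; first exact: fmap_proper_filter.
  apply/seteqP; split=> // A HA.
  have [//|FnA] := in_ultra_setVsetC (u @^-1` A) FU.
  have HnA : H (~` A) by apply: FH.
  have := filterI HA HnA; rewrite setICr => H0.
  by case: (@filter_not_empty _ _ HP (H0 _)).
have := @segment_compact R a b; rewrite compact_ultra => cab.
have [|l [_ ul]] := cab _ UF; last by apply/cvg_ex; exists l.
by apply: (@filterE _ F) => t; rewrite /= in_itv/=; exact: uab.
Qed.

Section AsymptoticCone.
Context (R : realType) (G : groupType) (N : group_norm R G).
Context (w : nonprincipal_ultrafilter) (s : scaling_sequence R w).

Definition admissible : set (nat -> G) :=
  [set x | exists C : R, forall n, N (x n) / s n <= C].

Definition rescaled_dist (x y : nat -> G) (n : nat) : R :=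
  gdist N (x n) (y n) / s n.

Definition cone_rel (x y : admissible) : bool :=
  `[< rescaled_dist (val x) (val y) n @[n --> ultra_sets w] --> (0 : R) >].

Lemma rescaled_dist_ge0 (x y : nat -> G) (n : nat) : 0 <= rescaled_dist x y n.
Proof. by rewrite divr_ge0 ?gdist_ge0// ltW// scale_gt0. Qed.

Lemma rescaled_dist_triangle (y x z : nat -> G) (n : nat) :
  rescaled_dist x z n <= rescaled_dist x y n + rescaled_dist y z n.
Proof.
rewrite -mulrDl ler_pM2r ?gdist_triangle//.
by rewrite invr_gt0 scale_gt0.
Qed.

Lemma rescaled_distC (x y : nat -> G) : rescaled_dist x y = rescaled_dist y x.
Proof. by apply/funext => n; rewrite /rescaled_dist gdistC. Qed.

Lemma rescaled_distxx (x : nat -> G) : rescaled_dist x x = cst 0.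
Proof. by apply/funext => n; rewrite /rescaled_dist gdistxx mul0r. Qed.

Lemma rescaled_dist_cvg (x y : admissible) :
  cvg (rescaled_dist (val x) (val y) n @[n --> ultra_sets w]).
Proof.
have /set_mem[C xC] := valP x; have /set_mem[D yD] := valP y.
apply: (@ultra_bounded_cvg _ _ _ _ _ 0 (C + D)) => n.
rewrite rescaled_dist_ge0/=.
apply: le_trans (rescaled_dist_triangle (cst 1%g) _ _ _) _.
rewrite [X in _ + X <= _](_ : _ = rescaled_dist (val y) (cst 1%g) n); last first.
  by rewrite rescaled_distC.
by rewrite lerD// /rescaled_dist gdist1 ?xC ?yD.
Qed.

Lemma cone_rel_refl : reflexive cone_rel.
Proof. by move=> x; apply/asboolP; rewrite rescaled_distxx; exact: cvg_cst. Qed.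

Lemma cone_rel_sym : symmetric cone_rel.
Proof. by move=> x y; rewrite /cone_rel rescaled_distC. Qed.

Lemma cone_rel_trans : transitive cone_rel.
Proof.
move=> y x z /asboolP xy /asboolP yz; apply/asboolP.
apply: (@squeeze_cvgr _ _ _ _ (cst 0)
  (rescaled_dist (val x) (val y) \+ rescaled_dist (val y) (val z))).
- apply: filterE => n.
  by rewrite rescaled_dist_ge0 /= rescaled_dist_triangle.
- exact: cvg_cst.
- by rewrite -[0 in X in _ --> X]addr0; exact: cvgD.
Qed.

Canonical cone_equiv :=
  EquivRel cone_rel cone_rel_refl cone_rel_sym cone_rel_trans.

Definition Cone := {eq_quot cone_equiv}.

HB.instance Definition _ := Choice.on Cone.

Definition cone_dist (x y : Cone) : R :=
  lim (rescaled_dist (val (repr x)) (val (repr y)) n @[n --> ultra_sets w]).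

(* [cone_dist] does not depend on the chosen representatives. *)
Lemma cone_dist_pi (x y : admissible) :
  cone_dist (\pi_Cone x) (\pi_Cone y) =
  lim (rescaled_dist (val x) (val y) n @[n --> ultra_sets w]).
Proof.
rewrite /cone_dist.
have rel (z : admissible) :
    rescaled_dist (val (repr (\pi_Cone z))) (val z) n @[n --> ultra_sets w] --> (0 : R).
  suff : cone_rel (repr (\pi_Cone z)) z by move/asboolP.
  by apply/eqmodP; rewrite reprK.
set x' := repr (\pi_Cone x); set y' := repr (\pi_Cone y).
apply/esym/cvg_lim => //.
have rc := @rescaled_dist_cvg x' y'.
have xx' := rel x; have yy' := rel y; rewrite -/x' -/y' in xx' yy'.
apply: (@squeeze_cvgr _ _ _ _
  (rescaled_dist (val x') (val y') \-
     (rescaled_dist (val x') (val x) \+ rescaled_dist (val y') (val y)))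
  (rescaled_dist (val x') (val y') \+
     (rescaled_dist (val x') (val x) \+ rescaled_dist (val y') (val y)))).
- apply: filterE => n /=; apply/andP; split.
    rewrite lerBlDr.
    apply: le_trans (rescaled_dist_triangle (val x) _ _ _) _.
    rewrite addrCA lerD2l.
    apply: le_trans (rescaled_dist_triangle (val y) _ _ _) _.
    by rewrite lerD2l rescaled_distC.
  apply: le_trans (rescaled_dist_triangle (val x') _ _ _) _.
  rewrite addrCA rescaled_distC lerD2l.
  exact: rescaled_dist_triangle.
- rewrite -[X in _ --> X]subr0; apply: cvgB => //.
  by rewrite -[0 in X in _ --> X]addr0; exact: cvgD.
- rewrite -[X in _ --> X]addr0; apply: cvgD => //.
  by rewrite -[0 in X in _ --> X]addr0; exact: cvgD.
Qed.

Lemma cone_distxx (x : Cone) : cone_dist x x = 0.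
Proof. by rewrite /cone_dist rescaled_distxx; exact: lim_cst. Qed.

Lemma cone_dist_positivity (x y : Cone) : cone_dist x y = 0 -> x = y.
Proof.
move=> xy0; rewrite -[x]reprK -[y]reprK; apply/eqmodP/asboolP.
by rewrite -xy0; exact: rescaled_dist_cvg.
Qed.

Lemma cone_dist_sym (x y : Cone) : cone_dist x y = cone_dist y x.
Proof. by rewrite /cone_dist rescaled_distC. Qed.

Lemma cone_dist_triangle (y x z : Cone) :
  cone_dist x z <= cone_dist x y + cone_dist y z.
Proof.
have xy := @rescaled_dist_cvg (repr x) (repr y).
have yz := @rescaled_dist_cvg (repr y) (repr z).
rewrite /cone_dist -limD//; apply: ler_lim.
- exact: rescaled_dist_cvg.
- exact: is_cvgD.
- by apply: filterE => n; exact: rescaled_dist_triangle.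
Qed.

HB.instance Definition _ := @isMetric.Build R Cone cone_dist
  cone_distxx cone_dist_positivity cone_dist_sym cone_dist_triangle.

End AsymptoticCone.

(* The homotopy is a total function on [R * X], of which only the restriction
   to `[0, 1] x X is constrained. *)
Definition homotopic (R : realType) (X Y : topologicalType) (f g : X -> Y) :=
  exists H : R * X -> Y,
    [/\ {within `[0, 1] `*` setT, continuous H},
        forall x, H (0, x) = f x & forall x, H (1, x) = g x].

Definition contractible (R : realType) (X : topologicalType) :=
  exists c : X, homotopic R (@id X) (cst c).

(* Main.v *)
(* The contraction is [H(t, [x_n]) = [p_k (x_n)]] with [k] the integer part of
   [t * N (x_n)].  By (iii), [H(1, [x_n])] has representatives of norm at most 1,
   which is negligible after rescaling.  By (i) and (ii),
   [d(H(t, x), H(t', y)) <= K d(x, y) + L (|t - t'| |x| + |t'| d(x, y))] in the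
   cone, the error of rounding to an integer being killed by the scaling
   sequence; this gives joint continuity. *)
Require Import Defs.
From mathcomp Require Import all_boot all_order all_algebra generic_quotient.
From mathcomp Require Import all_classical all_reals all_analysis.
From mathcomp Require Import lra.

Import Order.TTheory GRing.Theory Num.Theory.
Import numFieldNormedType.Exports.

Local Open Scope ring_scope.
Local Open Scope classical_set_scope.
Local Open Scope quotient_scope.

(** [Num.truncn] is 0 on negative reals, so the absolute value covers both signs. *)
Lemma truncn_le_norm {R : realType} (x : R) : (Num.truncn x)%:R <= `|x|.
Proof.
apply: (@le_trans _ _ (Num.truncn `|x|)%:R); last by rewrite truncn_le.
by rewrite ler_nat le_truncn// ler_norm.
Qed.

Lemma ler_dist_truncn {R : realType} (x y : R) :
  `|(Num.truncn x)%:R - (Num.truncn y)%:R| <= `|x - y| + 1.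
Proof.
wlog xy : x y / x <= y.
  by move=> W; have [/W//|/ltW /W] := leP x y; rewrite distrC (distrC x).
have txy : (Num.truncn x)%:R <= (Num.truncn y)%:R :> R.
  by rewrite ler_nat le_truncn.
rewrite distrC ger0_norm ?subr_ge0// distrC ger0_norm ?subr_ge0//.
have tx0 : 0 <= (Num.truncn x)%:R :> R by exact: ler0n.
have [y0|y0] := leP 0 y.
  have := truncnS_gt x; have := truncn_le y; rewrite y0 -natr1 => ? ?.
  lra.
(* Here [truncn_le] fails, but [y < 0] truncates to 0. *)
have /truncn0Pn -> : ~~ (1 <= y) by rewrite -ltNge (lt_trans y0).
lra.
Qed.

(** Reverse triangle inequality through the identity of [G]. *)
Lemma ler_dist_gnorm {R : realType} {G : groupType} (N : group_norm R G) g h :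
  `|N g - N h| <= gdist N g h.
Proof.
rewrite -!(gdist1 N) ler_norml; apply/andP; split.
  by rewrite lerNl opprB lerBlDr (gdistC N g h) gdist_triangle.
by rewrite lerBlDr gdist_triangle.
Qed.

Section RadialContraction.
Context {R : realType} {G : groupType} (N : group_norm R G).
Context {K L : R} {p : nat -> G -> G}.
Context (p_lip : forall (k : nat) (g h : G),
  gdist N (p k g) (p k h) <= K * gdist N g h).
Context (p_time_lip : forall (k l : nat) (g : G),
  gdist N (p k g) (p l g) <= L * `|k%:R - l%:R|).
Context (p_norm : forall (k : nat) (g : G), N (p k g) <= `|N g - k%:R|).
Context {w : nonprincipal_ultrafilter} (s : scaling_sequence R w).

Definition contract (t : R) (g : G) : G := p (Num.truncn (t * N g)) g.

(** [L] bounds the distance between the images of a point at times 0 and 1. *)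
Lemma time_lip_ge0 : 0 <= L.
Proof.
have := p_time_lip 0 1 1%g; rewrite sub0r normrN normr1 mulr1.
exact/le_trans/gdist_ge0.
Qed.

(** Pass through [g] moved for the time belonging to [(u, h)]: one leg changes only the time, the
    other only the point. [K] may be negative if [G] is trivial, hence [|K|]; the final 1 is the
    rounding error. *)
Lemma gdist_contract (t u : R) (g h : G) :
  gdist N (contract t g) (contract u h) <=
  `|K| * gdist N g h + L * (`|t - u| * N g + `|u| * gdist N g h + 1).
Proof.
apply: le_trans (gdist_triangle N (p (Num.truncn (u * N h)) g) _ _) _.
rewrite addrC lerD//.
  by apply: le_trans (p_lip _ _ _) _; rewrite ler_wpM2r ?gdist_ge0// ler_norm.
apply: le_trans (p_time_lip _ _ _) _; rewrite ler_wpM2l ?time_lip_ge0//.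
apply: le_trans (ler_dist_truncn _ _) _; rewrite lerD2r.
(* This splitting pairs [t - u] with [N g] alone, so the later constant depends only on the first
   point. *)
have -> : t * N g - u * N h = (t - u) * N g + u * (N g - N h) by lra.
apply: le_trans (ler_normD _ _) _.
by rewrite !normrM (ger0_norm (gnorm_ge0 _ _)) lerD2l ler_wpM2l// ler_dist_gnorm.
Qed.

(** A crude linear bound, from [|N g - k| <= N g + k]; it makes contracted sequences admissible. *)
Lemma gnorm_contract (t : R) (g : G) : N (contract t g) <= (1 + `|t|) * N g.
Proof.
apply: le_trans (p_norm _ _) _.
apply: le_trans (ler_normB _ _) _.
rewrite (ger0_norm (gnorm_ge0 _ _)) (ger0_norm (ler0n _ _)) mulrDl mul1r lerD2l.
apply: le_trans (truncn_le_norm _) _.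
by rewrite normrM (ger0_norm (gnorm_ge0 _ _)).
Qed.

Lemma gnorm_contract1 (g : G) : N (contract 1 g) <= 1.
Proof.
apply: le_trans (p_norm _ _) _; rewrite mul1r.
have := truncnS_gt (N g); have := truncn_le (N g).
rewrite gnorm_ge0 -natr1 => ? ?; rewrite ger0_norm; lra.
Qed.

Lemma admissible_contract (t : R) (x : nat -> G) :
  admissible N s x -> admissible N s (contract t \o x).
Proof.
move=> [C xC]; exists ((1 + `|t|) * C) => n /=.
apply: le_trans (_ : (1 + `|t|) * N (x n) / s n <= _).
  by rewrite ler_wpM2r ?invr_ge0 ?(ltW (scale_gt0 _ _))// gnorm_contract.
by rewrite -mulrA ler_wpM2l ?xC// addr_ge0.
Qed.

Lemma admissible_cst1 : admissible N s (cst 1%g).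
Proof.
exists 0 => n; suff -> : N (cst 1%g n) = 0 by rewrite mul0r.
exact/gnorm_eq0.
Qed.

Definition admissible_seq (x : nat -> G) (xs : admissible N s x) :
  admissible N s := exist _ x (mem_set xs).

(** Acts on the chosen representative [repr] of a class, hence is a function on the cone by
    construction. *)
Definition cone_contract (z : R * Cone N s) : Cone N s :=
  \pi_(Cone N s) (admissible_seq _
    (admissible_contract z.1 _ (set_mem (valP (repr z.2))))).

Lemma scaleV_cvg0 : (s n)^-1 @[n --> ultra_sets w] --> (0 : R).
Proof.
apply/gtr0_cvgV0; last exact: scale_cvg.
by apply: filterE => n; exact: scale_gt0.
Qed.

(** [C] bounds the rescaled norms of the representative of [X]; it is fixed before [t], [u] and [Y],
    as continuity at [X] requires. *)
Lemma cone_dist_contract (X : Cone N s) :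
  exists2 C : R, 0 <= C & forall (t u : R) (Y : Cone N s),
    cone_dist (cone_contract (t, X)) (cone_contract (u, Y)) <=
    `|K| * cone_dist X Y + L * (`|t - u| * C + `|u| * cone_dist X Y).
Proof.
have /set_mem[C xC] := valP (repr X); exists C.
  by apply: le_trans (xC 0%N); rewrite divr_ge0 ?gnorm_ge0// ltW// scale_gt0.
move=> t u Y; rewrite cone_dist_pi.
have rc := @rescaled_dist_cvg _ _ _ _ s (repr X) (repr Y).
set r := rescaled_dist N s (val (repr X)) (val (repr Y)) in rc.
(* The bound of [gdist_contract] divided by [s n], with the rescaled norm replaced by [C]. *)
pose b n := `|K| * r n + L * (`|t - u| * C + `|u| * r n + (s n)^-1).
have bl : b n @[n --> ultra_sets w] -->
    `|K| * cone_dist X Y + L * (`|t - u| * C + `|u| * cone_dist X Y).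
  apply: cvgD; first exact: cvgMl_tmp.
  apply: cvgMl_tmp; rewrite -[X in _ --> X]addr0.
  apply: cvgD; last exact: scaleV_cvg0.
  by apply: cvgD; [exact: cvg_cst|exact: cvgMl_tmp].
rewrite -(cvg_lim _ bl)//; apply: ler_lim.
- exact: rescaled_dist_cvg.
- by apply/cvg_ex; eexists; exact: bl.
apply: filterE => n; have s0 := scale_gt0 s n.
rewrite /rescaled_dist ler_pdivrMr//.
apply: le_trans (gdist_contract _ _ _ _) _.
rewrite /b /r /rescaled_dist mulrDl -!mulrA 2!mulrDl -!mulrA.
rewrite !mulVf ?gt_eqF// !mulr1 lerD2l ler_wpM2l ?time_lip_ge0// !lerD2r.
by rewrite ler_wpM2l// -ler_pdivrMr.
Qed.

Lemma cone_contract_continuous : continuous cone_contract.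
Proof.
move=> [t X]; apply/cvg_ballP => e e0.
have [C C0 HC] := cone_dist_contract X.
have L0 := time_lip_ge0.
(* Within radius [d <= 1] one has [|u| <= |t| + 1], so the estimate is at most [d * (M - 1)]. The
   extra 1 makes [M] positive and the inequality strict. *)
pose M := `|K| + L * (C + (`|t| + 1)) + 1.
have M0 : 0 < M by rewrite ltr_wpDl// addr_ge0// mulr_ge0// !addr_ge0.
pose d := Num.min 1 (e / M).
have d0 : 0 < d by rewrite lt_min ltr01 divr_gt0.
exists (ball t d, ball X d); first by split; exact: nbhsx_ballx.
move=> [u Y] [/= tu XY].
have {}tu : `|t - u| < d by [].
have {}XY : cone_dist X Y < d by move: XY; rewrite ballEmdist.
rewrite ballEmdist /=.
apply: le_lt_trans (HC t u Y) _.
have D0 : 0 <= cone_dist X Y by exact: (@mdist_ge0 _ (Cone N s) X Y).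
have u1 : `|u| <= `|t| + 1.
  rewrite -[u](subrKC t) (le_trans (ler_normD _ _))// lerD2l distrC.
  by rewrite (le_trans (ltW tu))// ge_min lexx.
apply: (@lt_le_trans _ _ (d * M)); last first.
  by rewrite -ler_pdivlMr// ge_min lexx orbT.
rewrite /M [d * _]mulrDr mulr1; apply: ltr_pwDr d0 _.
rewrite [d * _]mulrDr mulrCA lerD//.
  by rewrite mulrC ler_wpM2r// ltW.
rewrite ler_wpM2l// mulrDr lerD ?ler_wpM2r ?(ltW tu)//.
by rewrite mulrC ler_pM// ltW.
Qed.

Lemma cone_contract0 (X : Cone N s) : p 0%N = id -> cone_contract (0, X) = X.
Proof.
move=> p0; rewrite -[RHS]reprK; congr (\pi_(Cone N s) _); apply: val_inj => /=.
by apply/funext => n; rewrite /= /contract mul0r truncn0 p0.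
Qed.

Lemma cone_contract1 (X : Cone N s) :
  cone_contract (1, X) = \pi_(Cone N s) (admissible_seq _ admissible_cst1).
Proof.
apply/eqmodP/asboolP => /=.
(* The distance to the constant sequence is a norm at most 1, so [1 / s n] dominates after
   rescaling. *)
apply: (@squeeze_cvgr _ _ _ _ (cst 0) (fun n => (s n)^-1)) scaleV_cvg0.
  apply: filterE => n; rewrite rescaled_dist_ge0 /=.
  rewrite -[leRHS]mul1r ler_wpM2r ?invr_ge0 ?(ltW (scale_gt0 _ _))//.
  by rewrite gdist1 gnorm_contract1.
exact: cvg_cst.
Qed.

End RadialContraction.

Theorem lemma4p2 (R : realType) (G : groupType) (N : group_norm R G)
    (K L : R) (p : nat -> G -> G) :
  p 0%N = id ->
  (forall (k : nat) (g h : G), gdist N (p k g) (p k h) <= K * gdist N g h) ->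
  (forall (k l : nat) (g : G),
     gdist N (p k g) (p l g) <= L * `|k%:R - l%:R|) ->
  (forall (k : nat) (g : G), N (p k g) <= `|N g - k%:R|) ->
  forall (w : nonprincipal_ultrafilter) (s : scaling_sequence R w),
    contractible R (Cone N s).
Proof.
move=> p0 p_lip p_time_lip p_norm w s.
exists (\pi_(Cone N s) (admissible_seq N s _ (admissible_cst1 N s))).
exists (cone_contract N p_norm s); split=> [|X|X].
(* Continuity holds for all real times and restricts to the unit interval. *)
- exact/continuous_subspaceT/(cone_contract_continuous N p_lip p_time_lip).
- exact: cone_contract0.
- exact: cone_contract1.
Qed.
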